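(* For any topological space $X$, any functions $f_1,f_2:X\to\mathbb{R}^n$, and any $i\in\mathbb{Z}_{\ge0}$, $$d_I\big(H_i\circ F^S(X,f_1),\,H_i\circ F^S(X,f_2)\big)\le \sup_{x\in X}\|f_1(x)-f_2(x)\|_\infty .$$
   Context: Fix a field $k$ and $n\ge 1$. $B_n=k[\mathbb{R}_{\ge0}^n]$ is the monoid ring of $(\mathbb{R}^n_{\ge0},+)$. A $B_n$-persistence module is a $B_n$-module $M$ with a $k$-vector space decomposition $M=\bigoplus_{a\in\mathbb{R}^n}M_a$ such that $x_i^{\alpha}(M_a)\subset M_{a+\alpha \mathbf{e}_i}$ for all $a$, $\alpha\ge0$; morphisms are module homomorphisms $f$ with $f(M_a)\subset N_a$. For $a\le b$ (product order) the transition map $\varphi_M(a,b):M_a\to M_b$ is multiplication by $x_1^{b_1-a_1}\cdots x_n^{b_n-a_n}$. For $\epsilon\ge0$ let $\vec\epsilon=(\epsilon,\dots,\epsilon)$, $M(\epsilon)_a=M_{a+\vec\epsilon}$, $f(\epsilon)_a=f_{a+\vec\epsilon}$, and $S(M,\epsilon):M\to M(\epsilon)$ with $S(M,\epsilon)_a=\varphi_M(a,a+\vec\epsilon)$. $M,N$ are $\epsilon$-interleaved if there are morphisms $f:M\to N(\epsilon)$, $g:N\to M(\epsilon)$ with $g(\epsilon)\circ f=S(M,2\epsilon)$ and $f(\epsilon)\circ g=S(N,2\epsilon)$. $d_I(M,N)=\inf\{\epsilon\ge0: M,N\text{ are }\epsilon\text{-interleaved}\}\in[0,\infty]$. For a (not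 necessarily continuous) function $f:X\to\mathbb{R}^n$, $F^S(X,f)$ is the sublevelset filtration: $F^S(X,f)_a=\{x\in X: f(x)\le a\}$, with inclusions as transition maps. $H_i$ is the $i$-th persistent homology functor: $H_i(F)_a$ is the singular homology $H_i(F_a;k)$ and the transition maps of $H_i(F)$ are induced by those of the filtration $F$. *)

(* Defs.v *)
From HB Require Import structures.
From mathcomp Require Import all_boot all_order all_algebra.
From mathcomp Require Import all_classical reals ereal topology normedtype.
From mathcomp Require Import finmap zify.
From mathcomp Require Import -(notations) monalg.

Set Implicit Arguments.
Unset Strict Implicit.
Unset Printing Implicit Defensive.

Import Order.TTheory GRing.Theory Num.Theory.
Import numFieldNormedType.Exports.

Local Open Scope classical_set_scope.
Local Open Scope ring_scope.

Section LmodQuotient.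
Context (k : nzRingType) (V : lmodType k) (S : zmodClosed V).
Context (S_scale : forall (c : k) x, x \in S -> c *: x \in S).

(* The unused argument carries the proof of stability under scaling, from which
   the module structure on the quotient is built. *)
Definition lmquot of (forall (c : k) x, x \in S -> c *: x \in S) :=
  Quotient.quot S.

Notation Q := (lmquot S_scale).
HB.instance Definition _ := GRing.Zmodule.on Q.

Definition lmquot_pi (x : V) : Q := (\pi_(Quotient.quot S) x)%qT.

Lemma lmquot_pi_zmod : zmod_morphism lmquot_pi.
Proof. by move=> x y; rewrite /lmquot_pi [LHS]raddfB. Qed.

Lemma lmquot_eqP x y : reflect (lmquot_pi x = lmquot_pi y) (x - y \in S).
Proof. rewrite Quotient.idealrBE; exact: eqP. Qed.

Lemma lmquot_surj (q : Q) : exists x, q = lmquot_pi x.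
Proof. by exists (repr (q : Quotient.quot S)); rewrite /lmquot_pi reprK. Qed.

Definition lmquot_scale (c : k) (q : Q) : Q :=
  lmquot_pi (c *: repr (q : Quotient.quot S)).

Lemma lmquot_scaleE c x : lmquot_scale c (lmquot_pi x) = lmquot_pi (c *: x).
Proof.
apply/lmquot_eqP; rewrite -scalerBr; apply: S_scale; apply/lmquot_eqP.
by rewrite /lmquot_pi reprK.
Qed.

Let piB := lmquot_pi_zmod.
Let piD : {morph lmquot_pi : x y / x + y}.
Proof.
have pi0 : lmquot_pi 0 = 0 by rewrite -(subrr 0) piB subrr.
move=> x y; rewrite -{1}[y]opprK piB; congr (_ + _).
by rewrite -[- y]add0r piB pi0 add0r opprK.
Qed.

Let scaleA a b q : lmquot_scale a (lmquot_scale b q) = lmquot_scale (a * b) q.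
Proof. by have [x ->] := lmquot_surj q; rewrite !lmquot_scaleE scalerA. Qed.
Let scale1 : left_id 1 lmquot_scale.
Proof. by move=> q; have [x ->] := lmquot_surj q; rewrite lmquot_scaleE scale1r. Qed.
Let scaleDr : right_distributive lmquot_scale +%R.
Proof.
move=> c p q; have [x ->] := lmquot_surj p; have [y ->] := lmquot_surj q.
by rewrite -piD !lmquot_scaleE scalerDr piD.
Qed.
Let scaleDl q : {morph lmquot_scale^~ q : a b / a + b}.
Proof.
by move=> a b; have [x ->] := lmquot_surj q; rewrite !lmquot_scaleE scalerDl piD.
Qed.

HB.instance Definition _ :=
  GRing.Zmodule_isLmodule.Build k Q scaleA scale1 scaleDr scaleDl.

Lemma lmquot_pi_linear : linear lmquot_pi.
Proof. by move=> c x y; rewrite piD -lmquot_scaleE. Qed.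
HB.instance Definition _ := GRing.isLinear.Build k V Q _ lmquot_pi lmquot_pi_linear.

End LmodQuotient.

Section LmodQuotientMap.
Context (k : nzRingType) (V W : lmodType k) (S : zmodClosed V) (T : zmodClosed W).
Context (S_scale : forall (c : k) x, x \in S -> c *: x \in S).
Context (T_scale : forall (c : k) x, x \in T -> c *: x \in T).
Context (f : {linear V -> W}) (fST : forall x, x \in S -> f x \in T).

Definition lmquot_map of (forall x, x \in S -> f x \in T) :
    lmquot S_scale -> lmquot T_scale :=
  fun q => lmquot_pi T_scale (f (repr (q : Quotient.quot S))).

Lemma lmquot_mapE x :
  lmquot_map fST (lmquot_pi S_scale x) = lmquot_pi T_scale (f x).
Proof.
apply/lmquot_eqP; rewrite -raddfB; apply: fST; apply/(lmquot_eqP S_scale).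
by rewrite /lmquot_pi reprK.
Qed.

Lemma lmquot_map_linear : linear (lmquot_map fST).
Proof.
move=> c p q; have [x ->] := lmquot_surj p; have [y ->] := lmquot_surj q.
by rewrite -linearP !lmquot_mapE !linearP.
Qed.
HB.instance Definition _ := GRing.isLinear.Build k _ _ _ (lmquot_map fST)
  lmquot_map_linear.

End LmodQuotientMap.

Section FreeModule.
Context (k : nzRingType) (K : choiceType) (V : lmodType k) (h : K -> V).
Implicit Types c : malg K k.

(* [malg K k] is the free [k]-module on [K]; [malg_lift h] is the linear map
   sending the basis vector [s] to [h s]. *)
Definition malg_lift c : V := \sum_(s <- msupp c) mcoeff s c *: h s.

Lemma malg_liftEw (d : {fset K}%fset) c : (msupp c `<=` d)%fset ->
  malg_lift c = \sum_(s <- d) mcoeff s c *: h s.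
Proof.
move=> le; rewrite /malg_lift; apply: (big_fset_incl _ le) => //= x xd /mcoeff_outdom ->.
by rewrite scale0r.
Qed.

Lemma malg_lift_linear : linear malg_lift.
Proof.
move=> a c1 c2.
pose d := (msupp c1 `|` msupp c2)%fset.
rewrite (@malg_liftEw d); last first.
  apply: fsubset_trans (msuppD_le _ _) _; apply: fsetSU; exact: msuppZ_le.
rewrite (@malg_liftEw d c1) ?fsubsetUl// (@malg_liftEw d c2) ?fsubsetUr//.
rewrite scaler_sumr -big_split/=; apply: eq_bigr => s _.
by rewrite mcoeffD mcoeffZ scalerDl scalerA.
Qed.
HB.instance Definition _ := GRing.isLinear.Build k (malg K k) V _ malg_lift malg_lift_linear.

Lemma malg_liftU s a : malg_lift (mkmalgU s a) = a *: h s.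
Proof. by rewrite (malg_liftEw msuppU_le) big_seq_fset1 mcoeffUU. Qed.

End FreeModule.

Lemma malg_linear_ext (k : nzRingType) (K : choiceType) (V : lmodType k)
    (f g : {linear malg K k -> V}) :
  (forall s, f (mkmalgU s 1) = g (mkmalgU s 1)) -> f =1 g.
Proof.
move=> fg c; rewrite [c]monalgE !linear_sum; apply: eq_bigr => s _.
have -> : mkmalgU s (mcoeff s c) = mcoeff s c *: mkmalgU s 1.
  by apply/malgP => t; rewrite mcoeffZ !mcoeffU mulrnAr mulr1.
by rewrite !linearZ fg.
Qed.

Section SingularHomology.
Context (R : realType) (k : fieldType).
Implicit Types X Y Z : topologicalType.

Definition stdsimplex m : set 'rV[R]_m.+1 :=
  [set t | (forall j, 0 <= t 0 j) /\ \sum_j t 0 j = 1].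
Arguments stdsimplex : clear implicits.

Definition face_fun m (j : 'I_m.+2) (t : 'rV[R]_m.+1) : 'rV[R]_m.+2 :=
  \row_l (if unlift j l is Some l' then t 0 l' else 0).

Lemma face_fun_simplex m (j : 'I_m.+2) (t : stdsimplex m) :
  face_fun j (val t) \in stdsimplex m.+1.
Proof.
have [t0 t1] := set_valP t; apply/mem_set; split.
  by move=> l; rewrite mxE; case: unliftP.
rewrite (bigD1 j)//= mxE unlift_none add0r.
rewrite (reindex_omap (lift j) (unlift j)) /=; last first.
  by move=> l; rewrite eq_sym => /unlift_some[l' -> ->].
rewrite -[RHS]t1; apply: eq_big => [l|l _]; last by rewrite mxE liftK.
by rewrite liftK eqxx eq_sym neq_lift.
Qed.

Definition face_map m (j : 'I_m.+2) (t : stdsimplex m) : stdsimplex m.+1 :=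
  exist _ (face_fun j (val t)) (face_fun_simplex j t).

Lemma face_map_continuous m (j : 'I_m.+2) : continuous (@face_map m j).
Proof.
apply: continuous_comp_initial => t.
apply: (@continuous_comp _ _ _ (set_val : stdsimplex m -> _) (face_fun j)).
  exact: initial_continuous.
move=> U [P tP sPU].
have : \forall s \near nbhs (set_val t), forall i l, P i l (face_fun j s i l).
  apply: filter_forall => i; apply: filter_forall => l.
  have := tP i l; rewrite !mxE; under eq_near do rewrite mxE.
  case: unliftP => [l' _|_] tPl; first exact: (coord_continuous tPl).
  by apply: nearW => _; exact: nbhs_singleton.
by apply: filterS => s Ps; exact: sPU.
Qed.

Definition face m (j : 'I_m.+2) : continuousType (stdsimplex m) (stdsimplex m.+1) :=
  mkcts (@face_map_continuous m j).

(* Continuity is for the subspace topology on the standard simplex. *)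
Definition simplex m X := continuousType (stdsimplex m) X.

Definition chain m X := malg (simplex m X) k.
HB.instance Definition _ m X := GRing.Lmodule.on (chain m X).

Definition simplex_comp X Y (g : continuousType X Y) m (s : simplex m X) :
  simplex m Y := g \o s.

Definition simplex_face X m (s : simplex m.+1 X) j : simplex m X := s \o face j.

Definition boundary m X : {linear chain m.+1 X -> chain m X} :=
  malg_lift (fun s => \sum_(j < m.+2) (-1) ^+ j *: mkmalgU (simplex_face s j) 1).

Definition chain_map X Y (g : continuousType X Y) m :
    {linear chain m X -> chain m Y} :=
  malg_lift (fun s => mkmalgU (simplex_comp g s) 1).

Lemma chain_map_boundary X Y (g : continuousType X Y) m (c : chain m.+1 X) :
  boundary m Y (chain_map g m.+1 c) = chain_map g m (boundary m X c).
Proof.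
move: c; apply: (malg_linear_ext (f := boundary m Y \o chain_map g m.+1)
  (g := chain_map g m \o boundary m X)) => s.
rewrite /= !malg_liftU !scale1r malg_liftU scale1r linear_sum.
apply: eq_bigr => j _; rewrite linearZ/= malg_liftU scale1r.
by congr (_ *: mkmalgU _ _); apply/continuousEP.
Qed.

(* In degree 0 the boundary map is zero. *)
Definition cycle_pred i X : {pred chain i X} :=
  match i return {pred chain i X} with
  | 0 => predT
  | m.+1 => fun c => boundary m X c == 0
  end.

Lemma cycle_pred_closed i X : submod_closed (@cycle_pred i X).
Proof.
case: i => [|m]; split=> //; rewrite ?unfold_in ?linear0//.
by move=> a x y; rewrite !unfold_in linearP => /eqP-> /eqP->; rewrite scaler0 addr0.
Qed.
HB.instance Definition _ i X :=
  GRing.isSubmodClosed.Build k (chain i X) (@cycle_pred i X) (@cycle_pred_closed i X).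

Definition cycles i X := {c : chain i X | c \in @cycle_pred i X}.
HB.instance Definition _ i X := [isSub of cycles i X for @sval _ _].
HB.instance Definition _ i X := [Choice of cycles i X by <:].
HB.instance Definition _ i X := [SubChoice_isSubLmodule of cycles i X by <:].

(* The boundaries, as a subspace of the cycles; every boundary is a cycle by
   [boundary_boundary]. *)
Definition boundary_pred i X : {pred cycles i X} :=
  fun z => `[< exists c : chain i.+1 X, boundary i X c = \val z >].

Lemma boundary_predP i X (z : cycles i X) :
  reflect (exists c : chain i.+1 X, boundary i X c = \val z) (z \in @boundary_pred i X).
Proof. exact: asboolP. Qed.

Lemma boundary_pred_closed i X : zmod_closed (@boundary_pred i X).
Proof.
split; first by apply/boundary_predP; exists 0; rewrite linear0.
move=> x y /boundary_predP[c cx] /boundary_predP[d dy]; apply/boundary_predP.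
by exists (c - d); rewrite linearB/= cx dy.
Qed.
HB.instance Definition _ i X :=
  GRing.isZmodClosed.Build (cycles i X) (@boundary_pred i X) (@boundary_pred_closed i X).

Lemma boundary_pred_scale i X (a : k) (z : cycles i X) :
  z \in @boundary_pred i X -> a *: z \in @boundary_pred i X.
Proof.
move=> /boundary_predP[c cz]; apply/boundary_predP; exists (a *: c).
by rewrite linearZ/= cz.
Qed.

Definition homology i X : lmodType k := lmquot (@boundary_pred_scale i X).

Lemma cycles_map_subproof i X Y (g : continuousType X Y) (z : cycles i X) :
  chain_map g i (val z) \in @cycle_pred i Y.
Proof.
case: i z => [//|m] z; rewrite unfold_in chain_map_boundary.
have -> : boundary m X (val z) = 0 by exact: (eqP (valP z)).
by rewrite linear0.
Qed.

Definition cycles_map i X Y (g : continuousType X Y) (z : cycles i X) : cycles i Y :=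
  exist _ (chain_map g i (val z)) (cycles_map_subproof g z).

Lemma cycles_map_linear i X Y (g : continuousType X Y) : linear (@cycles_map i X Y g).
Proof. by move=> a x y; apply: val_inj; rewrite /= linearP. Qed.
HB.instance Definition _ i X Y g := GRing.isLinear.Build k (cycles i X) (cycles i Y) _
  (@cycles_map i X Y g) (@cycles_map_linear i X Y g).

Lemma cycles_map_boundary i X Y (g : continuousType X Y) (z : cycles i X) :
  z \in @boundary_pred i X -> cycles_map g z \in @boundary_pred i Y.
Proof.
move=> /boundary_predP[c cz]; apply/boundary_predP; exists (chain_map g i.+1 c).
by rewrite chain_map_boundary cz.
Qed.

Definition homology_map i X Y (g : continuousType X Y) :
    {linear homology i X -> homology i Y} :=
  @lmquot_map k _ _ _ _ (@boundary_pred_scale i X) (@boundary_pred_scale i Y)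
    (@cycles_map i X Y g) (@cycles_map_boundary i X Y g).

Lemma chain_map_id X (g : continuousType X X) m : g =1 id -> chain_map g m =1 id.
Proof.
move=> gid; apply: (malg_linear_ext (g := idfun)) => s; rewrite /= malg_liftU scale1r.
by congr mkmalgU; apply/continuousEP => t; exact: gid.
Qed.

Lemma chain_map_comp X Y Z (g : continuousType X Y) (h : continuousType Y Z)
    (gh : continuousType X Z) m : h \o g =1 gh ->
  chain_map h m \o chain_map g m =1 chain_map gh m.
Proof.
move=> ghE; apply: malg_linear_ext => s; rewrite /= !malg_liftU !scale1r malg_liftU scale1r.
by congr mkmalgU; apply/continuousEP => t; exact: ghE.
Qed.

Lemma homology_map_id i X (g : continuousType X X) :
  g =1 id -> homology_map i g =1 id.
Proof.
move=> gid q; have [z ->] := lmquot_surj q; rewrite [LHS]lmquot_mapE.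
by congr lmquot_pi; apply: val_inj; exact: chain_map_id.
Qed.

Lemma homology_map_comp i X Y Z (g : continuousType X Y) (h : continuousType Y Z)
    (gh : continuousType X Z) : h \o g =1 gh ->
  homology_map i h \o homology_map i g =1 homology_map i gh.
Proof.
move=> ghE q; have [z ->] := lmquot_surj q; rewrite /= /homology_map !lmquot_mapE.
by congr lmquot_pi; apply: val_inj; exact: chain_map_comp.
Qed.

End SingularHomology.

Section BoundaryBoundary.
Context (R : realType) (k : fieldType).

Let T m (t : 'rV[R]_m.+1) (p : nat) : R := oapp (t 0) 0 (insub p).

Let face_funE m (j : 'I_m.+2) (t : 'rV[R]_m.+1) (p : nat) : (p < m.+2)%N ->
  T (face_fun j t) p = if p == j then 0 else T t (unbump j p).
Proof.
move=> pm; rewrite /T insubT/= mxE; case: unliftP => [q /(congr1 val)/= pE|/(congr1 val)/= ->].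
  by rewrite pE bumpK eq_sym (negbTE (neq_bump _ _)) insubT//= => ?; congr (t 0 _); apply: val_inj.
by rewrite eqxx.
Qed.

Lemma face_face m (i : 'I_m.+2) (j : 'I_m.+3) (i' : 'I_m.+3) (j' : 'I_m.+2) 
   (t : 'rV[R]_m.+1) : (j <= i)%N -> i' = i.+1 :> nat -> j' = j :> nat ->
  face_fun i' (face_fun j' t) = face_fun j (face_fun i t).
Proof.
move=> ji i'E j'E; apply/rowP => l.
have TE m' (u : 'rV[R]_m'.+1) q : u 0 q = T u q by rewrite /T valK.
rewrite !TE; have lm := ltn_ord l; have im := ltn_ord i; rewrite [LHS]face_funE// [RHS]face_funE//.
case: eqVneq => li'; case: eqVneq => lj => //.
- rewrite face_funE; last by rewrite /unbump; lia.
  by case: eqVneq => // H; exfalso; move: H; rewrite /unbump; lia.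
- rewrite face_funE; last by rewrite /unbump; lia.
  by case: eqVneq => // H; exfalso; move: H; rewrite /unbump; lia.
- rewrite !face_funE; [|rewrite /unbump; lia|rewrite /unbump; lia].
  case: eqVneq => H1; case: eqVneq => H2 //; try by exfalso; move: H1 H2; rewrite /unbump; lia.
  by congr T; move: H1 H2; rewrite /unbump; lia.
Qed.

Lemma boundary_boundary m (X : topologicalType) (c : chain R k m.+2 X) :
  boundary R k m X (boundary R k m.+1 X c) = 0.
Proof.
move: c; apply: (malg_linear_ext (f := boundary R k m X \o boundary R k m.+1 X) (g := \0)) => s.
rewrite /= malg_liftU scale1r linear_sum.
under eq_bigr do rewrite linearZ/= malg_liftU scale1r scaler_sumr.
under eq_bigr do under eq_bigr do rewrite scalerA -exprD.
rewrite pair_big/= (bigID (fun p : 'I_m.+3 * 'I_m.+2 => (p.1 <= p.2)%N))/=.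
pose h (p : 'I_m.+3 * 'I_m.+2) : 'I_m.+3 * 'I_m.+2 := (lift ord0 p.2, inord p.1).
pose h' (p : 'I_m.+3 * 'I_m.+2) : 'I_m.+3 * 'I_m.+2 := (widen_ord (leqnSn _) p.2, inord p.1.-1).
rewrite [X in _ + X](reindex_onto h h') /=; last first.
  move=> [j i] /=; rewrite -ltnNge => ij; congr pair; apply: val_inj => /=.
    by rewrite /bump/= inordK; have := ltn_ord j; lia.
  by rewrite inord_val.
rewrite [X in _ + X](eq_bigl (fun p : 'I_m.+3 * 'I_m.+2 => (p.1 <= p.2)%N)); last first.
  move=> [j i] /=; apply/idP/idP.
    move=> /andP[]; rewrite -ltnNge /bump/= => + /eqP[/(congr1 val)/= jE _].
    by rewrite jE; lia.
  move=> ji; have jm : (j < m.+2)%N by have := ltn_ord i; lia.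
  rewrite -ltnNge /bump/= inordK// add1n ltnS ji/=; apply/eqP; congr pair; apply: val_inj => /=; first by rewrite inordK.
  by rewrite add0n inord_val.
  
rewrite -big_split big1//= => -[j i] /= ji.
have jm : (j < m.+2)%N by have := ltn_ord i; lia.
rewrite /bump/= inordK// add1n addSn exprS mulN1r scaleNr.
rewrite [X in _ - X](_ : _ = (-1) ^+ (j + i) *: mkmalgU (simplex_face (simplex_face s j) i) 1) ?subrr//.
rewrite addnC; congr (_ *: mkmalgU _ _); apply/continuousEP => t /=.
by congr (s _); apply: val_inj => /=; apply: face_face; rewrite //= inordK.
Qed.
End BoundaryBoundary.

Section ProductOrder.
Context (R : realType) (n : nat).
Implicit Types a b c v : 'rV[R]_n.

Definition lev a b := [forall i, a 0 i <= b 0 i].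

Lemma levP a b : reflect (forall i, a 0 i <= b 0 i) (lev a b).
Proof. exact: forallP. Qed.

Lemma lev_refl a : lev a a. Proof. exact/levP. Qed.

Lemma lev_trans b a c : lev a b -> lev b c -> lev a c.
Proof. by move=> /levP ab /levP bc; apply/levP => i; exact: le_trans (ab i) (bc i). Qed.

Lemma lev0D u v : lev 0 u -> lev 0 v -> lev 0 (u + v).
Proof.
move=> /levP u0 /levP v0; apply/levP => i; rewrite !mxE addr_ge0//.
  by have := u0 i; rewrite mxE.
by have := v0 i; rewrite mxE.
Qed.

Lemma lev_subl a v : lev 0 v -> lev (a - v) a.
Proof.
move=> /levP v0; apply/levP => i; rewrite !mxE gerBl.
by have := v0 i; rewrite mxE.
Qed.

End ProductOrder.

Section MonoidRing.
Context (R : realType) (n : nat).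

(* The commutative monoid of nonnegative vectors under addition, so that
   [monoid_ring] is its monoid ring over [k]. *)
Definition nnvec := {v : 'rV[R]_n | lev 0 v}.
HB.instance Definition _ := [isSub of nnvec for @sval _ _].
HB.instance Definition _ := [Choice of nnvec by <:].

Definition nnvec0 : nnvec := exist _ 0 (lev_refl 0).
Definition nnvecD (u v : nnvec) : nnvec :=
  exist _ (val u + val v) (lev0D (valP u) (valP v)).

Lemma nnvecDA : associative nnvecD.
Proof. by move=> u v w; apply: val_inj; exact: addrA. Qed.
Lemma nnvec0D : left_id nnvec0 nnvecD.
Proof. by move=> u; apply: val_inj; exact: add0r. Qed.
Lemma nnvecD0 : right_id nnvec0 nnvecD.
Proof. by move=> u; apply: val_inj; exact: addr0. Qed.
Lemma nnvecDC : commutative nnvecD.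
Proof. by move=> u v; apply: val_inj; exact: addrC. Qed.

Lemma nnvecD_eq0 u v : nnvecD u v = nnvec0 -> u = nnvec0 /\ v = nnvec0.
Proof.
suff H (a b : nnvec) : nnvecD a b = nnvec0 -> a = nnvec0.
  by move=> uv; split; apply: H uv || (apply: (H v u); rewrite nnvecDC).
move=> /(congr1 val)/= /rowP ab; apply: val_inj => /=.
apply/rowP => i; have /levP/(_ i) := valP a; have /levP/(_ i) := valP b.
have := ab i; rewrite !mxE => abi b0 a0.
by apply/eqP; rewrite eq_le a0 andbT -abi lerDl.
Qed.

HB.instance Definition _ :=
  Choice_isMonomialDef.Build nnvec nnvecDA nnvec0D nnvecD0 nnvecD_eq0.
HB.instance Definition _ := MonomialDef_isConomialDef.Build nnvec nnvecDC.

Context (k : fieldType).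

Definition monoid_ring : comNzRingType := malg nnvec k.

(* The monomial x_1^(v_1) ... x_n^(v_n). It is only meaningful for v >= 0; for any
   other v, [insubd] falls back to the monomial 1. *)
Definition xmon (v : 'rV[R]_n) : monoid_ring := mkmalgU (insubd nnvec0 v) 1.

Definition monoid_ring_const (c : k) : monoid_ring := mkmalgU nnvec0 c.

Lemma xmon0 : xmon 0 = 1.
Proof.
rewrite /xmon; have -> : insubd nnvec0 0 = nnvec0 :> nnvec.
  by apply: val_inj; rewrite val_insubd lev_refl.
exact: (erefl (fgone nnvec k)).
Qed.

Lemma xmonD u v : lev 0 u -> lev 0 v -> xmon (u + v) = xmon u * xmon v.
Proof.
move=> u0 v0; rewrite /xmon [RHS]fgmulUU mulr1.
have -> : insubd nnvec0 (u + v) = nnvecD (insubd nnvec0 u) (insubd nnvec0 v).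
  by apply: val_inj; rewrite /= !val_insubd lev0D// u0 v0.
by [].
Qed.

End MonoidRing.
Arguments monoid_ring : clear implicits.
Arguments xmon {R n k} v.

Section PersistenceModules.
Context (R : realType) (n : nat) (k : fieldType).
Implicit Types a b : 'rV[R]_n.

(* [pm_deg a] is the summand of degree a; the k-vector space structure is the one
   induced by the constants of the monoid ring. *)
Record persmod := PersMod {
  pm_mod :> lmodType (monoid_ring R n k);
  pm_deg : 'rV[R]_n -> set pm_mod;
  pm_deg0 : forall a, pm_deg a 0;
  pm_degD : forall a x y, pm_deg a x -> pm_deg a y -> pm_deg a (x + y);
  pm_degZ : forall a (c : k) x, pm_deg a x -> pm_deg a (monoid_ring_const R n c *: x);
  pm_direct : forall x, exists! c : 'rV[R]_n -> pm_mod,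
    [/\ forall a, pm_deg a (c a), finite_set [set a | c a != 0] &
        x = \sum_(a \in [set: 'rV[R]_n]) c a];
  pm_graded : forall a (i : 'I_n) (alpha : R) x, 0 <= alpha -> pm_deg a x ->
    pm_deg (a + alpha *: delta_mx 0 i) (xmon (alpha *: delta_mx 0 i) *: x)
}.

Record pmor (M N : persmod) := PMor {
  pmor_fun :> {linear M -> N};
  pmor_deg : forall a x, pm_deg a x -> pm_deg a (pmor_fun x)
}.

Lemma pm_degM (M : persmod) a v (x : M) :
  lev 0 v -> pm_deg a x -> pm_deg (a + v) (xmon v *: x).
Proof.
move=> v0 ax; have vi0 i : 0 <= v 0 i by have /levP/(_ i) := v0; rewrite mxE.
pose w m : 'rV[R]_n := \row_i (if (i < m)%N then v 0 i else 0).
have wP m : lev 0 (w m) by apply/levP => i; rewrite !mxE; case: ifP.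
suff H m : (m <= n)%N -> pm_deg (a + w m) (xmon (w m) *: x).
  have -> : v = w n by apply/rowP => i; rewrite mxE ltn_ord.
  exact: H.
elim: m => [_|m IH mn].
  have -> : w 0%N = 0 by apply/rowP => i; rewrite !mxE.
  by rewrite addr0 xmon0 scale1r.
pose i := Ordinal mn; pose e : 'rV[R]_n := v 0 i *: delta_mx 0 i.
have e0 : lev 0 e by apply/levP => j; rewrite !mxE mulr_ge0// ler0n.
have -> : w m.+1 = e + w m.
  apply/rowP => j; rewrite !mxE eqxx/= ltnS leq_eqVlt.
  have -> : (j == m :> nat) = (j == i) by [].
  by case: eqVneq => [->|_] /=; rewrite ?ltnn ?mulr1 ?addr0// mulr0 add0r.
rewrite xmonD// -scalerA addrCA addrC.
by apply: pm_graded => //; apply: IH; exact: ltnW.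
Qed.

(* Total in a, b and x, but only meaningful on [pm_deg a] for a <= b, where it
   takes values in [pm_deg b] (see [transition_deg]). *)
Definition transition (M : persmod) a b (x : M) : M := xmon (b - a) *: x.

Lemma transition_deg (M : persmod) a b (x : M) :
  lev a b -> pm_deg a x -> pm_deg b (transition a b x).
Proof.
move=> ab ax; have := @pm_degM M a (b - a) x _ ax; rewrite subrKC; apply.
by apply/levP => i; have /levP/(_ i) := ab; rewrite !mxE subr_ge0.
Qed.

Definition diagv (eps : R) : 'rV[R]_n := const_mx eps.

(* M(eps) has the same underlying module as M, with shifted degrees; likewise
   f(eps) has the same underlying map as f. *)
Section Shift.
Context (M : persmod) (eps : R).

Definition pm_shift_deg a : set M := pm_deg (a + diagv eps).

Lemma pm_shift_direct x : exists! c : 'rV[R]_n -> M,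
  [/\ forall a, pm_shift_deg a (c a), finite_set [set a | c a != 0] &
      x = \sum_(a \in [set: 'rV[R]_n]) c a].
Proof.
have reidx (c : 'rV[R]_n -> M) e :
    [/\ finite_set [set a | c a != 0] &
      x = \sum_(a \in [set: 'rV[R]_n]) c a] ->
    [/\ finite_set [set a | c (a + e) != 0] &
      x = \sum_(a \in [set: 'rV[R]_n]) c (a + e)].
  move=> [cf ->]; split.
    apply: (sub_finite_set _ (finite_image (fun a => a - e) cf)) => a ca.
    by exists (a + e) => //; rewrite addrK.
  apply: (reindex_fsbigT (fun a => a + e)).
  by exists (fun a => a - e) => a; rewrite ?addrK ?subrK.
have [c [[cd cf cx] cU]] := pm_direct x.
exists (fun a => c (a + diagv eps)); split.
  by have [? ?] := reidx c (diagv eps) (conj cf cx); split=> // b; exact: cd.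
move=> c' [c'd c'f c'x]; have [c''f c''x] := reidx c' (- diagv eps) (conj c'f c'x).
have -> : c = fun a => c' (a - diagv eps).
  by apply: cU; split=> // b; have := c'd (b - diagv eps); rewrite /pm_shift_deg subrK.
by apply/funext => b; rewrite addrK.
Qed.

Lemma pm_shift_graded a (i : 'I_n) (alpha : R) x : 0 <= alpha ->
  pm_shift_deg a x ->
  pm_shift_deg (a + alpha *: delta_mx 0 i) (xmon (alpha *: delta_mx 0 i) *: x).
Proof. by move=> alpha0 ax; rewrite /pm_shift_deg addrAC; exact: pm_graded. Qed.

Definition pm_shift : persmod := @PersMod M pm_shift_deg (fun a => pm_deg0 M _)
  (fun a => @pm_degD M _) (fun a => @pm_degZ M _)
  pm_shift_direct pm_shift_graded.

End Shift.

Definition pmor_shift (M N : persmod) (f : pmor M N) (eps : R) :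
    pmor (pm_shift M eps) (pm_shift N eps) :=
  @PMor (pm_shift M eps) (pm_shift N eps) f (fun a => @pmor_deg M N f (a + diagv eps)).

(* The morphism S(M, 2 eps) : M -> M(2 eps) is given in degree a by
   [transition a (a + diagv (2 * eps))], so the equalities of morphisms are stated
   degree by degree. *)
Definition interleaved (M N : persmod) (eps : R) : Prop :=
  exists (f : pmor M (pm_shift N eps)) (g : pmor N (pm_shift M eps)),
    (forall a (x : M), pm_deg a x ->
       pmor_shift g eps (f x) = transition a (a + diagv (2 * eps)) x) /\
    (forall a (y : N), pm_deg a y ->
       pmor_shift f eps (g y) = transition a (a + diagv (2 * eps)) y).

Definition interleaving_dist (M N : persmod) : \bar R :=
  ereal_inf [set eps%:E | eps in [set eps : R | 0 <= eps /\ interleaved M N eps]].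

End PersistenceModules.

Section DirectSum.
Context (k : nzRingType) (I : choiceType) (V : I -> lmodType k).

Record dsum := DSum {
  dsum_fun :> forall i, V i;
  dsum_finite : finite_set [set i | dsum_fun i != 0]
}.

Lemma dsumP (x y : dsum) : (forall i, x i = y i) -> x = y.
Proof.
case: x y => [x xf] [y yf] /= xy; have {}xy : x = y by apply: functional_extensionality_dep.
by case: _ / xy in yf *; congr DSum; exact: Prop_irrelevance.
Qed.

HB.instance Definition _ := gen_eqMixin dsum.
HB.instance Definition _ := gen_choiceMixin dsum.

Lemma dsum0_finite : finite_set [set i | (0 : V i) != 0].
Proof. by rewrite (_ : [set _ | _] = set0)// predeqE => i /=; rewrite eqxx. Qed.
Definition dsum0 := DSum dsum0_finite.

Lemma dsumN_finite (x : dsum) : finite_set [set i | - x i != 0].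
Proof. by apply: sub_finite_set (dsum_finite x) => i /=; rewrite oppr_eq0. Qed.
Definition dsumN x := DSum (dsumN_finite x).

Lemma dsumD_finite (x y : dsum) : finite_set [set i | x i + y i != 0].
Proof.
have: finite_set ([set i | x i != 0] `|` [set i | y i != 0]).
  by rewrite finite_setU; split; exact: dsum_finite.
apply: sub_finite_set => i /=; apply: contra_neqP => /not_orP[/negP + /negP].
by rewrite !negbK => /eqP-> /eqP->; rewrite addr0.
Qed.
Definition dsumD x y := DSum (dsumD_finite x y).

Lemma dsumZ_finite (c : k) (x : dsum) : finite_set [set i | c *: x i != 0].
Proof.
apply: sub_finite_set (dsum_finite x) => i /=; apply: contra_neq => ->.
exact: scaler0.
Qed.
Definition dsumZ c x := DSum (dsumZ_finite c x).

Lemma dsumDA : associative dsumD.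
Proof. by move=> x y z; apply: dsumP => i; exact: addrA. Qed.
Lemma dsumDC : commutative dsumD.
Proof. by move=> x y; apply: dsumP => i; exact: addrC. Qed.
Lemma dsum0D : left_id dsum0 dsumD.
Proof. by move=> x; apply: dsumP => i; exact: add0r. Qed.
Lemma dsumND : left_inverse dsum0 dsumN dsumD.
Proof. by move=> x; apply: dsumP => i; exact: addNr. Qed.
HB.instance Definition _ := GRing.isZmodule.Build dsum dsumDA dsumDC dsum0D dsumND.

Lemma dsumZA (a b : k) x : dsumZ a (dsumZ b x) = dsumZ (a * b) x.
Proof. by apply: dsumP => i; exact: scalerA. Qed.
Lemma dsum1Z : left_id 1 dsumZ.
Proof. by move=> x; apply: dsumP => i; exact: scale1r. Qed.
Lemma dsumZDr : right_distributive dsumZ +%R.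
Proof. by move=> c x y; apply: dsumP => i; exact: scalerDr. Qed.
Lemma dsumZDl x : {morph dsumZ^~ x : a b / a + b}.
Proof. by move=> a b; apply: dsumP => i; exact: scalerDl. Qed.
HB.instance Definition _ :=
  GRing.Zmodule_isLmodule.Build k dsum dsumZA dsum1Z dsumZDr dsumZDl.

Lemma dsum_sumE J (r : seq J) (P : pred J) (F : J -> dsum) i :
  (\sum_(j <- r | P j) F j) i = \sum_(j <- r | P j) F j i.
Proof. by apply: (big_morph (fun x : dsum => x i)). Qed.

End DirectSum.

Section PersistentVectorSpaces.
Context (R : realType) (n : nat) (k : fieldType).

Record persvect := PersVect {
  pv_sp :> 'rV[R]_n -> lmodType k;
  pv_map : forall a b, lev a b -> {linear pv_sp a -> pv_sp b};
  pv_id : forall a (aa : lev a a) x, pv_map aa x = x;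
  pv_comp : forall a b c (ab : lev a b) (bc : lev b c) (ac : lev a c) x,
    pv_map bc (pv_map ab x) = pv_map ac x
}.

Context (V : persvect).

Lemma pv_map0 a b (ab : lev a b) x : x = 0 -> pv_map V ab x = 0.
Proof. by move=> ->; exact: linear0. Qed.

(* The action of the monomial x^v on the direct sum of the V a: the component of
   degree b of x^v m is the image of the component of degree b - v of m. *)
Definition act_fun (v : nnvec R n) (x : dsum V) (b : 'rV[R]_n) : V b :=
  pv_map V (lev_subl b (valP v)) (x (b - val v)).

Lemma act_finite v (x : dsum V) : finite_set [set b | act_fun v x b != 0].
Proof.
apply: sub_finite_set (finite_image (fun a => a + val v) (dsum_finite x)).
move=> b /= nz; exists (b - val v); last by rewrite subrK.
by apply: contra_neq nz; exact: pv_map0.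
Qed.

Definition mon_act v (x : dsum V) : dsum V := DSum (act_finite v x).

Lemma mon_act_linear v : linear (mon_act v).
Proof. by move=> c x y; apply: dsumP => b; rewrite /= /act_fun linearP. Qed.
HB.instance Definition _ v :=
  GRing.isLinear.Build k (dsum V) (dsum V) _ (mon_act v) (mon_act_linear v).

Lemma pv_cast a b c (ac : lev a c) (bc : lev b c) (x : dsum V) : a = b ->
  pv_map V ac (x a) = pv_map V bc (x b).
Proof. by move=> ab; case: _ / ab in bc *; congr (pv_map V _ _); exact: bool_irrelevance. Qed.

Lemma mon_act0 x : mon_act (nnvec0 R n) x = x.
Proof.
apply: dsumP => b; rewrite /= /act_fun (pv_cast _ (lev_refl b)) ?pv_id//.
by rewrite /= subr0.
Qed.

Lemma mon_actD u v x : mon_act (nnvecD u v) x = mon_act u (mon_act v x).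
Proof.
apply: dsumP => b; rewrite /= /act_fun/=.
have H : lev (b - val u - val v) b.
  exact: lev_trans (lev_subl _ (valP v)) (lev_subl _ (valP u)).
by rewrite (pv_comp _ _ H); apply: pv_cast; rewrite opprD addrA.
Qed.

(* A copy of the direct sum, so that its module structure over the monoid ring does
   not interfere with its [k]-module structure. *)
Definition pv_module := dsum V.
HB.instance Definition _ := GRing.Zmodule.on pv_module.

Definition pv_scale (p : monoid_ring R n k) (x : pv_module) : pv_module :=
  malg_lift (fun v => mon_act v x) p.

Lemma pv_scaleDl x : {morph pv_scale^~ x : p q / p + q}.
Proof. move=> p q; exact: linearD. Qed.

Lemma pv_scaleDr : right_distributive pv_scale +%R.
Proof.
move=> p x y; rewrite /pv_scale /malg_lift -big_split; apply: eq_bigr => v _ /=.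
by rewrite linearD scalerDr.
Qed.

Lemma pv_scaleU v a x : pv_scale (mkmalgU v a) x = a *: (mon_act v x : dsum V).
Proof. exact: malg_liftU. Qed.

Lemma pv_scale1 : left_id 1 pv_scale.
Proof.
move=> x; rewrite -[LHS]/(pv_scale (mkmalgU (nnvec0 R n) 1) x).
by rewrite pv_scaleU scale1r mon_act0.
Qed.

Lemma pv_scale_suml (J : Type) (r : seq J) (P : pred J) (F : J -> monoid_ring R n k) x :
  pv_scale (\sum_(j <- r | P j) F j) x = \sum_(j <- r | P j) pv_scale (F j) x.
Proof. exact: linear_sum. Qed.

Lemma pv_scaleA p q x : pv_scale p (pv_scale q x) = pv_scale (p * q) x.
Proof.
rewrite [p * q]malgME pv_scale_suml {1}/pv_scale /malg_lift.
apply: eq_bigr => u _; rewrite pv_scale_suml /pv_scale {1}/malg_lift.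
rewrite linear_sum scaler_sumr; apply: eq_bigr => v _.
by rewrite malg_liftU linearZ/= scalerA [mmul _ _]/(nnvecD u v) mon_actD.
Qed.

HB.instance Definition _ := GRing.Zmodule_isLmodule.Build (monoid_ring R n k) pv_module
  pv_scaleA pv_scale1 pv_scaleDr pv_scaleDl.

End PersistentVectorSpaces.

Section PersVectToPersMod.
Context (R : realType) (n : nat) (k : fieldType) (V : persvect R n k).
Notation M := (pv_module V).
Implicit Types (a b : 'rV[R]_n) (x y : M).

Definition pv_deg a : set M := [set x | forall b, b != a -> x b = 0].

Lemma pv_deg0 a : pv_deg a 0. Proof. by []. Qed.

Lemma pv_degD a x y : pv_deg a x -> pv_deg a y -> pv_deg a (x + y).
Proof. by move=> ax ay b ba; rewrite /= ax// ay// addr0. Qed.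

Lemma pv_degZ a (c : k) x : pv_deg a x -> pv_deg a (monoid_ring_const R n c *: x).
Proof.
move=> ax b ba; rewrite [_ *: _](pv_scaleU (nnvec0 R n) c x) mon_act0 /=.
by rewrite ax// scaler0.
Qed.

Lemma pv_part_finite a x :
  finite_set [set b | (if b == a then x b else 0) != 0].
Proof.
by apply: sub_finite_set (dsum_finite x) => b /=; case: ifP => //; rewrite eqxx.
Qed.

Definition pv_part x a : M := DSum (pv_part_finite a x).

Lemma pv_direct x : exists! c : 'rV[R]_n -> M,
  [/\ forall a, pv_deg a (c a), finite_set [set a | c a != 0] &
      x = \sum_(a \in [set: 'rV[R]_n]) c a].
Proof.
have evalE (c : 'rV[R]_n -> M) b : (forall a, pv_deg a (c a)) ->
    finite_set [set a | c a != 0] ->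
    (\sum_(a \in [set: 'rV[R]_n]) c a : M) b = c b b.
  move=> cd cf; rewrite (fsbigTE (fset_set [set a | c a != 0])); last first.
    by move=> a; rewrite in_fset_set//; apply: contraNeq => ?; apply/mem_set.
  rewrite dsum_sumE; have [bc|bc] := boolP (b \in fset_set [set a | c a != 0]).
    rewrite (big_fsetD1 b)//= big1_fset ?addr0// => a; rewrite in_fsetD1.
    by move=> /andP[ab _] _; rewrite cd// eq_sym.
  have cb0 : c b = 0.
    by move: bc; rewrite in_fset_set// => /negP; apply: contra_notP => /eqP ?; apply/mem_set.
  rewrite cb0 big1_fset// => a aS _; rewrite cd//.
  by apply: contraNneq bc => ->.
have pd a : pv_deg a (pv_part x a) by move=> b ba /=; rewrite (negbTE ba).
have pf : finite_set [set a | pv_part x a != 0].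
  apply: sub_finite_set (dsum_finite x) => a /=; apply: contra_neq => xa.
  by apply: dsumP => b /=; case: eqVneq => // ->.
exists (pv_part x); split.
  by split=> //; apply: dsumP => b; rewrite evalE//= eqxx.
move=> c [cd cf xE]; apply/funext => a; apply: dsumP => b /=.
by case: eqVneq => [->|ba]; [rewrite xE evalE | rewrite cd].
Qed.

Lemma pv_graded a (i : 'I_n) (alpha : R) x : 0 <= alpha -> pv_deg a x ->
  pv_deg (a + alpha *: delta_mx 0 i) (xmon (alpha *: delta_mx 0 i) *: x).
Proof.
move=> alpha0 ax b; set v := alpha *: _ => ba.
have v0 : lev 0 v by apply/levP => j; rewrite !mxE mulr_ge0// ler0n.
rewrite [_ *: _](pv_scaleU (insubd (nnvec0 R n) v) 1 x) scale1r /= /act_fun.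
apply: pv_map0; apply: ax; rewrite val_insubd v0.
by apply: contra_neq ba => <-; rewrite subrK.
Qed.

(* The graded module associated with a functor from (R^n, <=) to k-vector spaces;
   by [pv_persmod_transition] its transition maps are those of the functor. *)
Definition pv_persmod : persmod R n k :=
  PersMod pv_deg0 pv_degD pv_degZ pv_direct pv_graded.

Lemma pv_persmod_transitionition a b (ab : lev a b) (x : pv_persmod) :
  (transition a b x : M) b = pv_map V ab ((x : M) a).
Proof.
have ba0 : lev 0 (b - a).
  by apply/levP => j; have /levP/(_ j) := ab; rewrite !mxE subr_ge0.
rewrite [transition a b x](pv_scaleU (insubd (nnvec0 R n) (b - a)) 1 x) scale1r.
by apply: pv_cast; rewrite val_insubd ba0 opprB addrC subrK.
Qed.

End PersVectToPersMod.

Section Filtrations.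
Context (R : realType) (n : nat).

Record filtration := Filtration {
  fil_sp :> 'rV[R]_n -> topologicalType;
  fil_map : forall a b, lev a b -> continuousType (fil_sp a) (fil_sp b);
  fil_id : forall a (aa : lev a a) x, fil_map aa x = x;
  fil_comp : forall a b c (ab : lev a b) (bc : lev b c) (ac : lev a c) x,
    fil_map bc (fil_map ab x) = fil_map ac x
}.

Section Inclusion.
Context (X : topologicalType) (A B : set X) (AB : A `<=` B).

Definition inclusion_fun (x : A) : B := exist _ (val x) (mem_set (AB (set_valP x))).

Lemma inclusion_continuous : continuous inclusion_fun.
Proof. by apply: continuous_comp_initial; exact: initial_continuous. Qed.

Definition inclusion : continuousType A B := mkcts inclusion_continuous.

End Inclusion.

Section Sublevel.
Context (X : topologicalType) (f : X -> 'rV[R]_n).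

Definition sublevel_set a : set X := [set x | lev (f x) a].

Lemma sublevel_set_sub a b : lev a b -> sublevel_set a `<=` sublevel_set b.
Proof. by move=> ab x xa; exact: lev_trans xa ab. Qed.

Definition sublevel_map a b (ab : lev a b) :
    continuousType (sublevel_set a) (sublevel_set b) :=
  inclusion (sublevel_set_sub ab).

Lemma sublevel_id a (aa : lev a a) x : sublevel_map aa x = x.
Proof. exact: val_inj. Qed.

Lemma sublevel_comp a b c (ab : lev a b) (bc : lev b c) (ac : lev a c) x :
  sublevel_map bc (sublevel_map ab x) = sublevel_map ac x.
Proof. exact: val_inj. Qed.

Definition sublevel_filtration : filtration :=
  @Filtration (fun a => sublevel_set a) sublevel_map sublevel_id sublevel_comp.

End Sublevel.

Section PersistentHomology.
Context (k : fieldType) (i : nat) (F : filtration).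

Lemma hom_fil_id a (aa : lev a a) x : homology_map R k i (fil_map F aa) x = x.
Proof. by apply: homology_map_id => y; exact: fil_id. Qed.

Lemma hom_fil_comp a b c (ab : lev a b) (bc : lev b c) (ac : lev a c) x :
  homology_map R k i (fil_map F bc) (homology_map R k i (fil_map F ab) x) =
  homology_map R k i (fil_map F ac) x.
Proof. by apply: homology_map_comp => y; exact: fil_comp. Qed.

Definition homology_persvect : persvect R n k :=
  @PersVect R n k (fun a => homology R k i (F a))
    (fun a b ab => homology_map R k i (fil_map F ab)) hom_fil_id hom_fil_comp.

Definition persistent_homology : persmod R n k := pv_persmod homology_persvect.

End PersistentHomology.
End Filtrations.

(* The supremum is taken in [0, +oo], hence is 0 when X is empty, whereas
   [ereal_sup set0] is -oo. The norm of row vectors is the max norm. *)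
Definition sup_dist (R : realType) (n : nat) (X : Type) (f g : X -> 'rV[R]_n) :
    \bar R :=
  Order.max 0%E (ereal_sup [set (`|f x - g x|)%:E | x in [set: X]]).

(* Main.v *)
(* If [|f1 - f2| <= eps] everywhere, the sublevel set of [f1] at [a] is contained in
   that of [f2] at [b] whenever [a + eps <= b], and vice versa. The maps induced by
   these inclusions on homology are natural, and a composite of two of them is again
   induced by an inclusion, so they form an [eps]-interleaving. *)

From HB Require Import structures.
Require Import Defs.
From mathcomp Require Import all_boot all_order all_algebra.
From mathcomp Require Import all_classical reals ereal topology normedtype.

Set Implicit Arguments.
Unset Strict Implicit.
Unset Printing Implicit Defensive.

Import Order.TTheory GRing.Theory Num.Theory.
Import numFieldNormedType.Exports.

Local Open Scope classical_set_scope.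
Local Open Scope ring_scope.

Section ShiftMorphism.
Context (R : realType) (n : nat) (k : fieldType) (V W : persvect R n k) (eps : R).

(* A morphism of degree [eps] is given by maps [V a -> W b] for all
   [a + eps <= b], not only for [b = a + eps]: its component of degree [b] is then
   defined on [V (b - eps)] without transport along [b - eps + eps = b]. *)
Record shift_family := ShiftFamily {
  sf_map : forall a b, lev (a + diagv n eps) b -> {linear V a -> W b};
  sf_target : forall a b c (ab : lev (a + diagv n eps) b) (bc : lev b c)
    (ac : lev (a + diagv n eps) c) x,
    pv_map W bc (sf_map ab x) = sf_map ac x;
  sf_source : forall a b c (ab : lev a b) (bc : lev (b + diagv n eps) c)
    (ac : lev (a + diagv n eps) c) x,
    sf_map bc (pv_map V ab x) = sf_map ac x
}.

Context (h : shift_family).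

(** Reconciles degrees that are equal but not convertible, such as [b - v - eps] and [b - eps - v]:
    [lev] is boolean, so its proofs are unique. *)
Lemma sf_cast a b c (ac : lev (a + diagv n eps) c) (bc : lev (b + diagv n eps) c)
    (x : dsum V) : a = b -> sf_map h ac (x a) = sf_map h bc (x b).
Proof.
move=> ab; case: _ / ab in bc *; congr (sf_map h _ _); exact: bool_irrelevance.
Qed.

Lemma lev_subK b : lev (b - diagv n eps + diagv n eps) b.
Proof. by rewrite subrK lev_refl. Qed.

Definition sf_component (x : dsum V) b : W b :=
  sf_map h (lev_subK b) (x (b - diagv n eps)).

Lemma sf_component_finite (x : dsum V) :
  finite_set [set b | sf_component x b != 0].
Proof.
apply: sub_finite_set (finite_image (fun a => a + diagv n eps) (dsum_finite x)).
move=> b /= nz; exists (b - diagv n eps); last by rewrite subrK.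
by apply: contra_neq nz; rewrite /sf_component => ->; rewrite linear0.
Qed.

Definition sf_dsum (x : dsum V) : dsum W := DSum (sf_component_finite x).

Lemma sf_dsum_linear : linear sf_dsum.
Proof. by move=> c x y; apply: dsumP => b; rewrite /= /sf_component linearP. Qed.
HB.instance Definition _ :=
  GRing.isLinear.Build k (dsum V) (dsum W) _ sf_dsum sf_dsum_linear.

(** In degree [b] both sides collapse to a single map of the family, out of the component of degree
    [b - v - eps]: one by [sf_source], the other by [sf_target]. *)
Lemma sf_dsum_mon_act v (x : dsum V) : sf_dsum (mon_act v x) = mon_act v (sf_dsum x).
Proof.
apply: dsumP => b; rewrite /= /sf_component /= /act_fun /= /sf_component.
have H : lev (b - val v - diagv n eps + diagv n eps) b.
  by rewrite subrK; exact: lev_subl (valP v).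
have H' : lev (b - diagv n eps - val v + diagv n eps) b.
  by rewrite addrAC subrK; exact: lev_subl (valP v).
rewrite (sf_target _ _ _ H) (sf_source _ _ _ H').
by apply: sf_cast; rewrite addrAC.
Qed.

(** Renames [sf_dsum] so that it can also carry linearity over the monoid ring. *)
Definition sf_module (x : pv_module V) : pv_module W := sf_dsum x.

Lemma sf_module_linear : linear sf_module.
Proof.
move=> p x y; rewrite /sf_module [LHS](linearD sf_dsum); congr (_ + _).
(* Expanding [p] over its support reduces the claim to monomials. *)
rewrite -[LHS]/(sf_dsum (pv_scale p x)) -[RHS]/(pv_scale p (sf_dsum x)).
rewrite /pv_scale /malg_lift linear_sum; apply: eq_bigr => v _.
by rewrite linearZ/= sf_dsum_mon_act.
Qed.
HB.instance Definition _ := GRing.isLinear.Build (monoid_ring R n k)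
  (pv_module V) (pv_module W) _ sf_module sf_module_linear.

Lemma sf_module_deg a (x : pv_persmod V) :
  pm_deg a x -> @pm_deg _ _ _ (pm_shift (pv_persmod W) eps) a (sf_module x).
Proof.
move=> ax b ba; rewrite /= /sf_component ax ?linear0//.
by apply: contra_neq ba => <-; rewrite subrK.
Qed.

Definition sf_pmor : pmor (pv_persmod V) (pm_shift (pv_persmod W) eps) :=
  @PMor _ _ _ (pv_persmod V) (pm_shift (pv_persmod W) eps) sf_module sf_module_deg.

End ShiftMorphism.

(** [transition] multiplies by the monomial of exponent [2 * eps], so in degree [b] both sides apply
    a structure map of [V] to the component of degree [b - 2 * eps]. *)
Lemma sf_module_comp (R : realType) (n : nat) (k : fieldType) (V W : persvect R n k)
    (eps : R) (h : shift_family V W eps) (h' : shift_family W V eps) :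
  0 <= eps ->
  (forall a b c (ab : lev (a + diagv n eps) b) (bc : lev (b + diagv n eps) c)
     (ac : lev a c) x, sf_map h' bc (sf_map h ab x) = pv_map V ac x) ->
  forall a (x : pv_persmod V),
    sf_module h' (sf_module h x) = transition a (a + diagv n (2 * eps)) x.
Proof.
move=> eps0 hh' a x; rewrite /transition [a + _]addrC addrK.
(* Nonnegativity keeps [insubd] from falling back to exponent 0. *)
have e0 : lev 0 (diagv n (2 * eps)) by apply/levP => i; rewrite !mxE mulr_ge0.
rewrite [RHS](pv_scaleU (insubd (nnvec0 R n) (diagv n (2 * eps))) 1 x) scale1r.
apply: dsumP => b; rewrite /= /sf_component /= /sf_component /act_fun.
have dE : b - diagv n eps - diagv n eps = b - diagv n (2 * eps).
  by apply/rowP => i; rewrite !mxE mulr2n mulrDl mul1r opprD addrA.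
have bb : lev (b - diagv n eps - diagv n eps) b.
  by rewrite dE; exact: lev_subl.
rewrite (hh' _ _ _ _ _ bb); apply: pv_cast.
by rewrite val_insubd e0.
Qed.

Lemma interleaved_shift_family (R : realType) (n : nat) (k : fieldType)
    (V W : persvect R n k) (eps : R)
    (h : shift_family V W eps) (h' : shift_family W V eps) :
  0 <= eps ->
  (forall a b c (ab : lev (a + diagv n eps) b) (bc : lev (b + diagv n eps) c)
     (ac : lev a c) x, sf_map h' bc (sf_map h ab x) = pv_map V ac x) ->
  (forall a b c (ab : lev (a + diagv n eps) b) (bc : lev (b + diagv n eps) c)
     (ac : lev a c) x, sf_map h bc (sf_map h' ab x) = pv_map W ac x) ->
  interleaved (pv_persmod V) (pv_persmod W) eps.
Proof.
move=> eps0 hV hW; exists (sf_pmor h), (sf_pmor h').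
by split=> a x _; exact: sf_module_comp.
Qed.

Lemma normr_coord_le (R : realType) (m n : nat) (A : 'M[R]_(m, n)) i j :
  `|A i j| <= `|A|.
Proof.
by rewrite [leRHS]/Num.Def.normr/= mx_normrE; exact: (le_bigmax _ _ (i, j)).
Qed.

Section SublevelInterleaving.
Context (R : realType) (k : fieldType) (n : nat) (X : topologicalType).
Context (i : nat) (eps : R).
Implicit Types f g : X -> 'rV[R]_n.

Lemma sublevel_set_shift f g a b : (forall x, `|f x - g x| <= eps) ->
  lev (a + diagv n eps) b -> sublevel_set f a `<=` sublevel_set g b.
Proof.
move=> fg /levP ab x /levP fa; apply/levP => j; apply: le_trans (ab j).
(* It remains to bound the coordinate of [g x] by that of [f x] plus the max norm of [f x - g x]. *)
rewrite !mxE; apply: le_trans (lerD (fa j) (fg x)).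
rewrite -lerBlDl; apply: le_trans (ler_norm _) _; rewrite distrC.
by have := normr_coord_le (f x - g x) 0 j; rewrite !mxE.
Qed.

Definition sublevel_shift_family f g (fg : forall x, `|f x - g x| <= eps) :
  shift_family (homology_persvect k i (sublevel_filtration f))
    (homology_persvect k i (sublevel_filtration g)) eps.
Proof.
exists (fun a b (ab : lev (a + diagv n eps) b) =>
  homology_map R k i (inclusion (sublevel_set_shift fg ab))).
(* Both composites are induced by inclusions, which are determined by the underlying points of
   [X]. *)
- by move=> a b c ab bc ac x; apply: homology_map_comp => y; exact: val_inj.
- by move=> a b c ab bc ac x; apply: homology_map_comp => y; exact: val_inj.
Defined.

Lemma sublevel_interleaved f g : 0 <= eps -> (forall x, `|f x - g x| <= eps) ->
  interleaved (persistent_homology k i (sublevel_filtration f))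
    (persistent_homology k i (sublevel_filtration g)) eps.
Proof.
move=> eps0 fg; have gf x : `|g x - f x| <= eps by rewrite distrC.
(* Going across and back is an inclusion between sublevel sets of one function, hence induces a
   structure map. *)
apply: (interleaved_shift_family (h := sublevel_shift_family fg)
  (h' := sublevel_shift_family gf)) => // a b c ab bc ac x;
  by apply: homology_map_comp => y; exact: val_inj.
Qed.

End SublevelInterleaving.

Theorem theorem2p8p1 (R : realType) (k : fieldType) (n : nat) (hn : (0 < n)%N)
    (X : topologicalType) (f1 f2 : X -> 'rV[R]_n) (i : nat) :
  (interleaving_dist
     (persistent_homology k i (sublevel_filtration f1))
     (persistent_homology k i (sublevel_filtration f2))
   <= sup_dist f1 f2)%E.
Proof.
have d0 : (0 <= sup_dist f1 f2)%E by rewrite /sup_dist le_max lexx.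
have fd x : ((`|f1 x - f2 x|)%:E <= sup_dist f1 f2)%E.
  by rewrite /sup_dist le_max; apply/orP; right; apply: ereal_sup_ubound; exists x.
(* [d0] excludes [-oo]. A finite value [e] is itself an interleaving parameter, so it bounds the
   infimum directly. *)
move: (sup_dist f1 f2) d0 fd => [e| |]// e0 fe; last exact: leey.
apply: ereal_inf_lbound; exists e => //; split; first by rewrite -lee_fin.
by apply: sublevel_interleaved => [|x]; rewrite -lee_fin.
Qed.
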